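(* Given two graphs $\Gamma_1$ and $\Gamma_2\subset\mathbb{R}^n$ with $\Gamma_1\cap\Gamma_2=\{p_1,\dots,p_N\}$, the net total curvature of $\Gamma=\Gamma_1\cup\Gamma_2$ obeys the sub-additivity law $$\mathrm{NTC}(\Gamma)=\mathrm{NTC}(\Gamma_1)+\mathrm{NTC}(\Gamma_2)+2\pi\sum_{j=1}^N\frac{1}{|S^{n-1}|}\int_{S^{n-1}}\big[\mathrm{nlm}^+_\Gamma(e,p_j)-\mathrm{nlm}^+_{\Gamma_1}(e,p_j)-\mathrm{nlm}^+_{\Gamma_2}(e,p_j)\big]\,dA_{S^{n-1}}(e)$$ $$\le\mathrm{NTC}(\Gamma_1)+\mathrm{NTC}(\Gamma_2),$$ where $|S^{n-1}|$ is the total area of $S^{n-1}$ (so that for $n=3$ the prefactor $2\pi/|S^{n-1}|$ is $\frac12$). In particular, additivity $\mathrm{NTC}(\Gamma)=\mathrm{NTC}(\Gamma_1)+\mathrm{NTC}(\Gamma_2)$ holds if and only if $$\mathrm{nlm}_{\Gamma_1}(e,p_j)\,\mathrm{nlm}_{\Gamma_2}(e,p_j)\ge0$$ for all points $p_j$ of $\Gamma_1\cap\Gamma_2$ and almost all $e\in S^{n-1}$.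
   Context: Graphs are finite and piecewise $C^2$: finitely many vertices and edges, and after adding finitely many vertices of degree 2 each edge is a regular $C^2$ arc up to its endpoints. The degree $d(q)$ of a vertex is the number of edges ending at it (loops count twice); an interior point of an edge is regarded as a vertex of degree 2. The points $p_j$ are taken as vertices of $\Gamma_1$, $\Gamma_2$ and $\Gamma$. At a vertex $q$ of degree $d$ let $T_1,\dots,T_d\in S^{n-1}$ be the unit tangent vectors pointing into the edges ending at $q$, and $\chi_i:S^{n-1}\to\{\pm1\}$ be $-1$ on the hemisphere centered at $T_i$, $+1$ on the opposite hemisphere. $\mathrm{ntc}(q)=\pi$ times the average over $e\in S^{n-1}$ of $\big[\sum_{i=1}^d\chi_i(e)\big]^+$, and $\mathrm{NTC}(\Gamma)=\sum_q\mathrm{ntc}(q)+\int_{\Gamma_{\rm reg}}|\vec k|\,ds$, the sum over all vertices, the integral of the curvature over the open $C^2$ edges. The double of a graph has the same vertices and two copies of each edge; a parameterization of it is a mapping from a compact 1-manifold without boundary covering each doubled edge exactly once, so $d(q)$ points lie over each vertex $q$. $\mathrm{nlm}_\Gamma(e,q)=\frac12[\mathrm{lmax}(e,q)-\mathrm{lmin}(e,q)]$, where $\mathrm{lmax}$ and $\mathrm{lmin}$ are the numbers of local maxima and local minima of $\langle e,\cdot\rangle$ along the parameterization among the points over $q$ (defined for a.a. $e$; independent of the parameterization). $\mathrm{nlm}^+=\max(\mathrm{nlm},0)$. *)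

(* Defs.v *)
From HB Require Import structures.
From mathcomp Require Import all_boot all_order all_algebra.
From mathcomp Require Import finmap.
From mathcomp Require Import all_classical all_reals all_analysis.
From mathcomp Require Import measurable_realfun.

Set Implicit Arguments.
Unset Strict Implicit.
Unset Printing Implicit Defensive.
Import Order.TTheory GRing.Theory Num.Theory.
Import numFieldNormedType.Exports.

Local Open Scope classical_set_scope.
Local Open Scope ring_scope.

Section measurable_rV.
Variables (R : realType) (n : nat).

Let coord (i : 'I_n) (x : 'rV[R]_n) := x 0 i.

Let rV_set0 : g_sigma_preimage coord set0.
Proof. exact: sigma_algebra0. Qed.

Let rV_setC A : g_sigma_preimage coord A -> g_sigma_preimage coord (~` A).
Proof. exact: sigma_algebraC. Qed.

Let rV_bigcup (F : (set 'rV[R]_n)^nat) :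
  (forall i, g_sigma_preimage coord (F i)) ->
  g_sigma_preimage coord (\bigcup_i F i).
Proof. exact: sigma_algebra_bigcup. Qed.

(* The product sigma-algebra, which is the Borel one. *)
HB.instance Definition _ := @isMeasurable.Build default_measure_display
  'rV[R]_n (g_sigma_preimage coord) rV_set0 rV_setC rV_bigcup.

End measurable_rV.

Lemma measurable_coord (R : realType) (n : nat) (i : 'I_n) :
  measurable_fun setT (fun x : 'rV[R]_n => x 0 i).
Proof.
move=> _ Y mY; rewrite setTI; apply: sub_sigma_algebra => /=.
rewrite -bigcup_seq/=; exists i => /=; first by rewrite mem_index_enum.
by exists Y => //; rewrite setTI.
Qed.

Lemma measurable_fun_rV d (T : measurableType d) (R : realType) (n : nat)
    (f : T -> 'rV[R]_n) :
  (forall i, measurable_fun setT (fun x => f x 0 i)) ->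
  measurable_fun setT f.
Proof.
move=> mf _ A mA; rewrite setTI.
pose c (i : 'I_n) (x : 'rV[R]_n) := x 0 i.
have : g_sigma_preimage (fun i => c i \o f) `<=` measurable.
  apply: smallest_sub; first exact: sigma_algebra_measurable.
  rewrite -bigcup_seq/=; apply: bigcup_sub => i _ B [C mC <-].
  exact: (mf i measurableT C mC).
apply; rewrite g_sigma_preimage_comp; exists A => //.
by rewrite setTI.
Qed.

Section lebesgue_rVS.
Variables (R : realType) (n : nat).
Variable m : {sigma_finite_measure set 'rV[R]_n -> \bar R}.

Definition consrV (x : measurableTypeR R * 'rV[R]_n) : 'rV[R]_n.+1 :=
  row_mx (x.1 : R)%:M x.2.

Let splitrV (x : 'rV[R]_n.+1) : measurableTypeR R * 'rV[R]_n :=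
  (x 0 0, rsubmx (x : 'rV[R]_(1 + n))).

Let consrVK : cancel consrV splitrV.
Proof.
move=> [a x]; rewrite /splitrV /consrV row_mxKr; congr pair.
have -> : (0 : 'I_n.+1) = @lshift 1 n ord0 by exact: val_inj.
by rewrite (row_mxEl (a%:M : 'M[R]_1)) mxE eqxx.
Qed.

Lemma measurable_consrV : measurable_fun setT consrV.
Proof.
apply: measurable_fun_rV => i; case: (@split_ordP 1 n i) => j ->.
- rewrite (_ : (fun _ => _) = (fun x => x.1 : R)); first exact: measurable_fst.
  by apply/funext => x; rewrite /consrV (row_mxEl ((x.1 : R)%:M : 'M[R]_1)) !ord1 mxE eqxx.
- rewrite (_ : (fun _ => _) = (fun y : 'rV[R]_n => y 0 j) \o snd).
    by apply: measurableT_comp; [exact: measurable_coord|exact: measurable_snd].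
  by apply/funext => x /=; rewrite /consrV (row_mxEr ((x.1 : R)%:M : 'M[R]_1)).
Qed.

Let measurable_splitrV : measurable_fun setT splitrV.
Proof.
apply/measurable_fun_pairP; split => /=.
  exact: (@measurable_coord R n.+1 0).
apply: measurable_fun_rV => i /=.
rewrite (_ : (fun _ => _) = (fun y : 'rV[R]_n.+1 => y 0 (rshift 1 i))).
  exact: (@measurable_coord R n.+1 (rshift 1 i)).
by apply/funext => x; rewrite /= mxE.
Qed.

Definition lebesgue_rVS : set 'rV[R]_n.+1 -> \bar R :=
  pushforward (lebesgue_measure \x m)%E consrV.

Let lebesgue_rVS0 : lebesgue_rVS set0 = 0%E.
Proof. by rewrite /lebesgue_rVS /pushforward preimage_set0 measure0. Qed.

Let lebesgue_rVS_ge0 A : (0 <= lebesgue_rVS A)%E.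
Proof. exact: (measure_ge0 (lebesgue_measure \x m)%E). Qed.

Let lebesgue_rVS_sigma_additive : semi_sigma_additive lebesgue_rVS.
Proof.
apply: measure_semi_sigma_additive; exact: measurable_consrV.
Qed.

HB.instance Definition _ := isMeasure.Build _ _ _ lebesgue_rVS
  lebesgue_rVS0 lebesgue_rVS_ge0 lebesgue_rVS_sigma_additive.

Let lebesgue_rVS_sigma_finite : sigma_finite setT lebesgue_rVS.
Proof.
have /sigma_finiteP[F [TF ndF Foo]] := sigma_finiteT (@lebesgue_measure R).
have /sigma_finiteP[G [TG ndG Goo]] := sigma_finiteT m.
exists (fun k => splitrV @^-1` (F k `*` G k)).
  apply/seteqP; split => // x _.
  have [k _ Fk] : (\bigcup_k F k) (splitrV x).1 by rewrite -TF.
  have [l _ Gl] : (\bigcup_k G k) (splitrV x).2 by rewrite -TG.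
  exists (maxn k l) => //; split.
  - by move: Fk; exact/subsetPset/ndF/leq_maxl.
  - by move: Gl; exact/subsetPset/ndG/leq_maxr.
move=> k; have [mF Fk] := Foo k; have [mG Gk] := Goo k; split.
  rewrite -[X in measurable X]setTI; apply: measurable_splitrV => //.
  exact: measurableX.
rewrite /lebesgue_rVS /pushforward -comp_preimage (_ : _ \o _ = id); last first.
  exact/funext/consrVK.
by rewrite preimage_id product_measure1E// lte_mul_pinfty// ge0_fin_numE.
Qed.

HB.instance Definition _ := Measure_isSigmaFinite.Build _ _ _ lebesgue_rVS
  lebesgue_rVS_sigma_finite.

End lebesgue_rVS.

Fixpoint lebesgue_rV (R : realType) (n : nat) :
    {sigma_finite_measure set 'rV[R]_n -> \bar R} :=
  if n is k.+1 then lebesgue_rVS (lebesgue_rV R k) else \d_ (0 : 'rV[R]_0).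

Section euclidean.
Variables (R : realType) (n : nat).
Implicit Types x y e : 'rV[R]_n.

Definition dot x y : R := \sum_i x 0 i * y 0 i.

(* Not the library's `|x|, which is the sup norm. *)
Definition enorm x : R := Num.sqrt (dot x x).

Definition unitv x : 'rV[R]_n := (enorm x)^-1 *: x.

Definition sphere : set 'rV[R]_n := [set e | enorm e = 1].

Definition punctured_ball : set 'rV[R]_n := [set x | 0 < enorm x <= 1].

Let measurable_dot : measurable_fun setT (fun x => dot x x).
Proof.
by apply: measurable_sum => i; apply: measurable_funM; exact: measurable_coord.
Qed.

Let measurable_enorm : measurable_fun setT enorm.
Proof.
rewrite (_ : enorm = (@powR R ^~ 2^-1) \o (fun x => dot x x)).
  by apply: measurableT_comp => //; exact: measurable_powR.
apply/funext => x /=; rewrite powR12_sqrt//.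
by apply: sumr_ge0 => i _; rewrite -expr2 sqr_ge0.
Qed.

Lemma measurable_unitv : measurable_fun setT unitv.
Proof.
apply: measurable_fun_rV => i.
rewrite (_ : (fun _ => _) = (fun x => enorm x `^ (-1) * x 0 i)).
  apply: measurable_funM; last exact: measurable_coord.
  by apply: (measurableT_comp (@measurable_powR R (-1))).
by apply/funext => x; rewrite powR_inv1 ?sqrtr_ge0// mxE.
Qed.

Lemma measurable_punctured_ball : measurable punctured_ball.
Proof.
rewrite (_ : punctured_ball = enorm @^-1` `]0, 1]).
  by rewrite -[X in measurable X]setTI; apply: measurable_enorm.
by apply/seteqP; split => x /=; rewrite in_itv.
Qed.

(* Surface area: that of A is n times the volume of the cone
   { x | 0 < |x| <= 1 and x/|x| in A }. *)
Definition sphere_measure : set 'rV[R]_n -> \bar R :=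
  pushforward
    (mscale n%:R%:nng (mrestr (lebesgue_rV R n) measurable_punctured_ball))
    unitv.

Let sphere_measure0 : sphere_measure set0 = 0%E.
Proof. by rewrite /sphere_measure /pushforward preimage_set0 measure0. Qed.

Let sphere_measure_ge0 A : (0 <= sphere_measure A)%E.
Proof.
exact: (measure_ge0
  (mscale n%:R%:nng (mrestr (lebesgue_rV R n) measurable_punctured_ball))).
Qed.

Let sphere_measure_sigma_additive : semi_sigma_additive sphere_measure.
Proof. by apply: measure_semi_sigma_additive; exact: measurable_unitv. Qed.

HB.instance Definition _ := isMeasure.Build _ _ _ sphere_measure
  sphere_measure0 sphere_measure_ge0 sphere_measure_sigma_additive.

(* |S^(n-1)| *)
Definition sphere_area : R := fine (sphere_measure sphere).

Definition sphere_average (f : 'rV[R]_n -> R) : R :=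
  sphere_area^-1 * \int[sphere_measure]_(e in sphere) f e.

End euclidean.

Section curves.
Variables (R : realType) (n : nat).
Implicit Type c : R -> 'rV[R]_n.

(* The arc itself is the restriction of c to [0, 1]; being C^2 up to the end
   points is expressed by c being C^2 on all of R. *)
Definition C2_curve c : Prop :=
  [/\ forall t, derivable c t 1,
      forall t, derivable (derive1 c) t 1
    & continuous (derive1 (derive1 c))].

Definition speed c (t : R) : R := enorm (derive1 c t).

(* The curvature vector dT/ds, with T = dc/ds and ds = speed * dt. *)
Definition curvature_vector c (t : R) : 'rV[R]_n :=
  (speed c t)^-1 *: derive1 (fun u => unitv (derive1 c u)) t.

Definition total_curvature c : R :=
  \int[lebesgue_measure]_(t in `]0, 1[) (enorm (curvature_vector c t) * speed c t).

End curves.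

(* A finite piecewise C^2 graph embedded in R^n, corners of its edges being
   listed among the vertices (with degree 2). Edges may be loops. *)
Record graph (R : realType) (n : nat) := Graph {
  vert : {fset 'rV[R]_n};
  edge : finType;
  curve : edge -> R -> 'rV[R]_n;
  curve_C2 : forall a, C2_curve (curve a);
  curve_regular : forall a t, 0 <= t <= 1 -> derive1 (curve a) t != 0;
  curve_ends : forall a, curve a 0 \in vert /\ curve a 1 \in vert;
  curve_interior : forall a t, 0 < t < 1 -> curve a t \notin vert;
  curve_inj : forall a b s t, 0 < s < 1 -> 0 < t < 1 ->
    curve a s = curve b t -> a = b /\ s = t
}.
Arguments curve {R n g}.

Section graphs.
Variables (R : realType) (n : nat).
Implicit Types (G : graph R n) (q e T : 'rV[R]_n).

Definition carrier G : set 'rV[R]_n :=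
  [set x | x \in vert G \/ exists a t, 0 <= t <= 1 /\ @curve _ _ G a t = x].

(* The ends of the edges of G are the pairs (a, b) : edge G * bool; (a, false) is the end of a at parameter 0 and
   (a, true) the one at parameter 1, so that a loop has two ends at its vertex. *)
Definition end_vertex G (h : edge G * bool) : 'rV[R]_n :=
  curve h.1 (if h.2 then 1 else 0).

(* Points into the edge. *)
Definition end_tangent G (h : edge G * bool) : 'rV[R]_n :=
  if h.2 then - unitv (derive1 (curve h.1) 1) else unitv (derive1 (curve h.1) 0).

(* The value on the equator is immaterial. *)
Definition chi T e : R := if 0 <= dot e T then -1 else 1.

Definition ntc G q : R :=
  pi * sphere_average
    (fun e => Num.max (\sum_(h | @end_vertex G h == q) chi (end_tangent h) e) 0).

Definition NTC G : R :=
  \sum_(q <- vert G) ntc G q + \sum_(a : edge G) total_curvature (curve a).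

End graphs.

Section union.
Variables (R : realType) (n : nat) (G1 G2 : graph R n).
Hypothesis meet_vert : forall x, carrier G1 x -> carrier G2 x ->
  x \in vert G1 /\ x \in vert G2.

Definition union_curve (a : edge G1 + edge G2) : R -> 'rV[R]_n :=
  match a with inl a1 => curve a1 | inr a2 => curve a2 end.

Let vertU := (vert G1 `|` vert G2)%fset.

Let union_C2 a : C2_curve (union_curve a).
Proof. by case: a => a; exact: curve_C2. Qed.

Let union_regular a t : 0 <= t <= 1 -> derive1 (union_curve a) t != 0.
Proof. by case: a => a; exact: curve_regular. Qed.

Let union_ends a : union_curve a 0 \in vertU /\ union_curve a 1 \in vertU.
Proof.
by case: a => a; have [a0 a1] := curve_ends a; rewrite !in_fsetU /= a0 a1 ?orbT.
Qed.

Let carrier_curve G (a : edge G) (t : R) : 0 < t < 1 ->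
  @carrier R n G (curve a t).
Proof.
by move=> /andP[t0 t1]; right; exists a, t; split=> //; rewrite !ltW.
Qed.

Let carrier_vert G x : x \in vert G -> @carrier R n G x.
Proof. by left. Qed.

Let union_interior a t : 0 < t < 1 -> union_curve a t \notin vertU.
Proof.
move=> t01; rewrite in_fsetU negb_or; case: a => a /=.
- have na := curve_interior a t01; rewrite na /=.
  apply: contra na => /carrier_vert a2.
  by have [] := meet_vert (carrier_curve a t01) a2.
- have na := curve_interior a t01; rewrite na andbT.
  apply: contra na => /carrier_vert a1.
  by have [] := meet_vert a1 (carrier_curve a t01).
Qed.

Let union_disjoint (a : edge G1) (b : edge G2) s t : 0 < s < 1 -> 0 < t < 1 ->
  curve a s <> curve b t.
Proof.
move=> s01 t01 ab; have sa := carrier_curve a s01.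
have sb : carrier G2 (curve a s) by rewrite ab; exact: carrier_curve.
by have [+ _] := meet_vert sa sb; rewrite (negbTE (curve_interior a s01)).
Qed.

Let union_inj a b s t : 0 < s < 1 -> 0 < t < 1 ->
  union_curve a s = union_curve b t -> a = b /\ s = t.
Proof.
move=> s01 t01; case: a b => [a|a] [b|b] /= ab.
- by have [-> ->] := curve_inj s01 t01 ab.
- by case: (union_disjoint s01 t01 ab).
- by case: (union_disjoint t01 s01 (esym ab)).
- by have [-> ->] := curve_inj s01 t01 ab.
Qed.

Definition union_graph : graph R n :=
  Graph union_C2 union_regular union_ends union_interior union_inj.

Lemma carrier_union_graph : carrier union_graph = carrier G1 `|` carrier G2.
Proof.
apply/seteqP; split => x.
- case=> [|[[a|a] [t [t01 <-]]]].
  + by rewrite /= in_fsetU => /orP[]; [left; left|right; left].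
  + by left; right; exists a, t.
  + by right; right; exists a, t.
- case=> -[xv|[a [t [t01 <-]]]].
  + by left; rewrite /= in_fsetU xv.
  + by right; exists (inl a), t.
  + by left; rewrite /= in_fsetU xv orbT.
  + by right; exists (inr a), t.
Qed.

End union.

Lemma meet_vertices (R : realType) (n N : nat) (G1 G2 : graph R n)
    (p : 'I_N -> 'rV[R]_n) :
  carrier G1 `&` carrier G2 = range p ->
  (forall j, p j \in vert G1) -> (forall j, p j \in vert G2) ->
  forall x, carrier G1 x -> carrier G2 x -> x \in vert G1 /\ x \in vert G2.
Proof.
move=> G12 p1 p2 x x1 x2.
by have [j _ <-] : range p x by rewrite -G12.
Qed.

(* Compact 1-manifold without boundary: every point lies in the open image of a
   homeomorphic copy of the real line. *)
Definition closed_1manifold (R : realType) (M : topologicalType) : Prop :=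
  [/\ compact [set: M], hausdorff_space M
    & forall x : M, exists g : R -> M,
        [/\ continuous g, injective g,
            forall A : set R, open A -> open (g @` A) & range g x]].

(* A parameterization of the double of G, whose edges are the pairs (a, i) with
   i : bool. For each of them, dp_arc (a, i) t is the point of the 1-manifold
   lying over the point curve a t of the i-th copy of a; the arcs cover the
   manifold, and no interior point of an arc is attained a second time. *)
Record double_param (R : realType) (n : nat) (G : graph R n) := DoubleParam {
  dp_space : topologicalType;
  dp_manifold : closed_1manifold R dp_space;
  dp_map : dp_space -> 'rV[R]_n;
  dp_continuous : continuous dp_map;
  dp_arc : edge G * bool -> R -> dp_space;
  dp_arc_continuous : forall a, {within `[0, 1], continuous (dp_arc a)};
  dp_arcE : forall a t, 0 <= t <= 1 -> dp_map (dp_arc a t) = curve a.1 t;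
  dp_cover : forall x, exists a t, 0 <= t <= 1 /\ dp_arc a t = x;
  dp_once : forall a b s t, 0 < s < 1 -> 0 <= t <= 1 ->
    dp_arc a s = dp_arc b t -> a = b /\ s = t
}.

Section local_extrema.
Variables (R : realType) (n : nat) (G : graph R n) (D : double_param G).
Implicit Types e q : 'rV[R]_n.

Definition local_max e (x : dp_space D) : Prop :=
  \forall y \near x, dot e (dp_map y) <= dot e (dp_map x).

Definition local_min e (x : dp_space D) : Prop :=
  \forall y \near x, dot e (dp_map x) <= dot e (dp_map y).

(* The sets counted are finite: by dp_cover and curve_interior, every point over
   a vertex is an end point of one of the finitely many arcs. *)
Definition lmax e q : nat :=
  #|` fset_set [set x : dp_space D | dp_map x = q /\ local_max e x]|%fset.

Definition lmin e q : nat :=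
  #|` fset_set [set x : dp_space D | dp_map x = q /\ local_min e x]|%fset.

Definition nlm e q : R := ((lmax e q)%:R - (lmin e q)%:R) / 2.

Definition nlm_pos e q : R := Num.max (nlm e q) 0.

End local_extrema.

(* Main.v *)
Require Import Defs.
From mathcomp Require Import all_boot all_order all_algebra.
From mathcomp Require Import finmap.
From mathcomp Require Import all_classical all_reals all_analysis.
From mathcomp Require Import measurable_realfun ring lra.

Set Implicit Arguments.
Unset Strict Implicit.
Unset Printing Implicit Defensive.
Import Order.TTheory GRing.Theory Num.Theory.
Import numFieldNormedType.Exports.

Local Open Scope classical_set_scope.
Local Open Scope ring_scope.

(** For a direction e and a vertex q let S_G(e, q) = net_chi G q e be the sum of
    the signs chi_i(e) over the ends of edges of G at q. Two facts give the
    result.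

    The first is that the numbers S are additive: the ends of the edges of the
    union at q are those of G1 and those of G2 (net_chi_union). As ntc(q) is pi
    times the average of the positive part S^+, the total NTC(G) differs from
    NTC(G1) + NTC(G2) only at the common points p_j, and there by pi times the
    average of the defect S_1^+ + S_2^+ - (S_1 + S_2)^+ (NTC_union). The defect
    is nonnegative, and it vanishes if and only if S_1 S_2 >= 0
    (pos_defect_ge0, pos_defect_eq0); this is the inequality, and the equality
    case in terms of S.

    The second is that nlm(e, q) = S(e, q) / 2 for almost all e (nlmE), whatever
    the parameterization of the double. The exceptional directions are those
    orthogonal to the tangent at some end of an edge; they lie in finitely many
    great subspheres and form a null set (ae_generic). For the other directions
    the height is strictly monotone near the ends of the edges (end_descent).
    The parameterization enters through its topology only: a neighbourhood of a
    point x over a vertex is the union of the beginnings of the arcs that start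
    at x, and since x also has a neighbourhood homeomorphic to the line, there
    are exactly two of them (two_arms). So x is a local maximum if both descend,
    a local minimum if both ascend, and neither otherwise
    (local_extremum_chi). Each end at q occurs twice over q, because the graph
    is doubled, and this turns the difference of the numbers of maxima and
    minima into S(e, q). *)

(** * Integrals and null sets *)

Section null_integral.
Context d (T : measurableType d) (R : realType).
Variable mu : {measure set T -> \bar R}.
Import HBNNSimple.

(** The functions f and g are arbitrary because this is applied to numbers of
    local extrema, which depend on the higher-order behaviour of the curves at
    directions orthogonal to a tangent, and whose measurability on that null
    set is not clear. The integral is a supremum over simple functions, and
    multiplying a simple function by the indicator of the complement of a null
    set keeps its integral. *)
Lemma eq_integral_ae (D : set T) (f g : T -> \bar R) :
  {ae mu, forall x, D x -> f x = g x} ->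
  (\int[mu]_(x in D) f x = \int[mu]_(x in D) g x)%E.
Proof.
move=> [N [mN N0 fgN]].
have fg x : ~ N x -> D x -> f x = g x.
  by move=> Nx; apply: contrapT => fgx; exact/Nx/fgN.
pose nnint (k : T -> \bar R) := ereal_sup [set sintegral mu h |
  h in [set h : {nnsfun T >-> R} | forall x, ((h x)%:E <= k x)%E]].
suff le_nnint (k l : T -> \bar R) : (forall x, 0 <= l x)%E ->
    (forall x, ~ N x -> k x = l x) -> (nnint k <= nnint l)%E.
  have eq_nnint (k l : T -> \bar R) : (forall x, 0 <= k x)%E ->
      (forall x, 0 <= l x)%E -> (forall x, ~ N x -> k x = l x) ->
      nnint k = nnint l.
    move=> k0 l0 kl; apply/eqP; rewrite eq_le !le_nnint// => x Nx.
    by rewrite kl.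
  have fgD x : ~ N x -> (f \_ D) x = (g \_ D) x.
    by move=> Nx; rewrite /patch; case: ifPn => // /set_mem Dx; exact: fg.
  rewrite /integral; congr (_ - _)%E.
  - by apply: eq_nnint => x; [exact: funepos_ge0|exact: funepos_ge0|
      move=> Nx; rewrite !funeposE fgD].
  - by apply: eq_nnint => x; [exact: funeneg_ge0|exact: funeneg_ge0|
      move=> Nx; rewrite !funenegE fgD].
move=> l0 kl; apply: ge_ereal_sup => _ /= [h hk <-].
have mNC : measurable (~` N) by exact: measurableC.
apply: ereal_sup_ge; exists (sintegral mu (proj_nnsfun h mNC)).
  exists (proj_nnsfun h mNC) => // x /=.
  rewrite mindicE; case: (pselect (N x)) => Nx.
    by rewrite memNset ?mulr0//=; apply.
  by rewrite mem_set// mulr1 -kl.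
rewrite -!integralT_nnsfun; rewrite (ge0_negligible_integral (N := N))//.
  have /eq_integral -> : {in setT `\` N, (fun x => (h x)%:E) =1
      (fun x => (proj_nnsfun h mNC x)%:E)}.
    by move=> x; rewrite setTD inE => Nx /=; rewrite mindicE mem_set// mulr1.
  apply: ge0_subset_integral => //; first exact: measurableD.
    exact/measurable_EFinP.
  by move=> x _; rewrite lee_fin; exact: fun_ge0.
- exact/measurable_EFinP.
- by move=> x _; rewrite lee_fin; exact: fun_ge0.
Qed.

Lemma eq_Rintegral_ae (D : set T) (f g : T -> R) :
  {ae mu, forall x, D x -> f x = g x} ->
  \int[mu]_(x in D) f x = \int[mu]_(x in D) g x.
Proof.
move=> fg; congr fine; apply: eq_integral_ae.
by apply: filterS fg => x fgx Dx; rewrite fgx.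
Qed.

End null_integral.

(** * Hyperplanes are null, and the sphere has finite area *)

Section euclidean_measure.
Variable R : realType.

Lemma measurable_dotl n (T : 'rV[R]_n) :
  measurable_fun setT (fun x : 'rV[R]_n => dot x T).
Proof.
apply: measurable_sum => i; apply: measurable_funM => //.
exact: measurable_coord.
Qed.

Lemma measurable_hyperplane n (T : 'rV[R]_n) c :
  measurable [set x : 'rV[R]_n | dot x T = c].
Proof.
rewrite -[X in measurable X]setTI.
exact (@measurable_dotl n T measurableT [set c] (measurable_set1 c)).
Qed.

Lemma consrV0 n (a : R) (x : 'rV[R]_n) : consrV (a, x) 0 ord0 = a.
Proof.
rewrite /consrV (_ : ord0 = @lshift 1 n ord0); last exact: val_inj.
by rewrite (row_mxEl ((a : R)%:M : 'M[R]_1)) mxE eqxx.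
Qed.

Lemma consrVS n (a : R) (x : 'rV[R]_n) i : consrV (a, x) 0 (rshift 1 i) = x 0 i.
Proof. by rewrite /consrV (row_mxEr ((a : R)%:M : 'M[R]_1)). Qed.

Lemma dot_consrV n (x : measurableTypeR R * 'rV[R]_n) (T : 'rV[R]_n.+1) :
  dot (consrV x) T = x.1 * T 0 0 + dot x.2 (rsubmx (T : 'rV[R]_(1 + n))).
Proof.
case: x => a x; rewrite /dot (@big_split_ord _ _ _ 1 n) /= big_ord1.
rewrite (_ : lshift n 0 = ord0) ?consrV0; last exact: val_inj.
by congr (_ + _); apply: eq_bigr => i _; rewrite consrVS mxE.
Qed.

(** Induction on the dimension by slicing along the first coordinate; affine
    hyperplanes, and not only linear ones, occur because the slices of a
    linear hyperplane are translated. *)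
Lemma lebesgue_hyperplane n (T : 'rV[R]_n) c : T != 0 ->
  lebesgue_rV R n [set x | dot x T = c] = 0%E.
Proof.
elim: n T c => [|n IH] T c; first by rewrite [T]thinmx0 eqxx.
move=> T0; rewrite /= /lebesgue_rVS /pushforward.
set H := (X in (_ \x _)%E X).
have mH : measurable H.
  rewrite -[H]setTI; apply: measurable_consrV => //.
  exact: measurable_hyperplane.
have HE x y : H (x, y) <-> x * T 0 0 + dot y (rsubmx (T : 'rV[R]_(1 + n))) = c.
  by rewrite -(dot_consrV (x, y)).
(* Either each slice is a hyperplane in one dimension less, or the hyperplane
   is a product of a point with the remaining space. *)
have [T'0|T'0] := eqVneq (rsubmx (T : 'rV[R]_(1 + n))) 0; last first.
  rewrite /product_measure1 integral0_eq// => x _ /=.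
  rewrite -(IH _ (c - x * T 0 0) T'0); congr (lebesgue_rV _ _ _).
  apply/seteqP; split=> y; rewrite /xsection /= inE HE /=.
    by move=> <-; rewrite addrAC subrr add0r.
  by move=> ->; rewrite addrC subrK.
have T00 : T 0 0 != 0.
  apply: contra_neq T0 => T00; apply/rowP => i; rewrite mxE.
  case: (@split_ordP 1 n i) => j ->.
    by rewrite -[RHS]T00 ord1; congr (T _ _); exact: val_inj.
  by move/rowP: T'0 => /(_ j); rewrite !mxE.
have -> : H = [set c / T 0 0] `*` setT.
  apply/seteqP; split=> -[x y]; rewrite HE T'0 /dot big1 ?addr0/=.
  - by move=> <-; rewrite mulfK.
  - by move=> i _; rewrite mxE mulr0.
  - by move=> [-> _]; rewrite mulfVK.
  - by move=> i _; rewrite mxE mulr0.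
rewrite product_measure1E// [X in (X * _)%E](_ : _ = 0%E) ?mul0e//.
exact: lebesgue_measure_set1.
Qed.

End euclidean_measure.

Section sphere_measure_theory.
Variables (R : realType) (n : nat).
Implicit Types x e T : 'rV[R]_n.

Lemma dot_ge0 x : 0 <= dot x x.
Proof. by apply: sumr_ge0 => i _; rewrite -expr2 sqr_ge0. Qed.

Lemma dotC x e : dot x e = dot e x.
Proof. by apply: eq_bigr => i _; rewrite mulrC. Qed.

Lemma dotZl (a : R) x e : dot (a *: x) e = a * dot x e.
Proof. by rewrite /dot mulr_sumr; apply: eq_bigr => i _; rewrite mxE mulrA. Qed.

Lemma dotBr x e T : dot x (e - T) = dot x e - dot x T.
Proof.
by rewrite /dot -sumrB; apply: eq_bigr => i _; rewrite !mxE mulrBr.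
Qed.

Lemma enorm_gt0 x : (0 < enorm x) = (x != 0).
Proof.
rewrite /enorm sqrtr_gt0 lt_neqAle dot_ge0 andbT eq_sym; congr (~~ _).
apply/eqP/eqP => [|->]; last by rewrite /dot big1// => i _; rewrite mxE mul0r.
move=> /eqP; rewrite psumr_eq0 => [/allP x0|i _]; last first.
  by rewrite -expr2 sqr_ge0.
apply/rowP => i; rewrite mxE; apply/eqP; rewrite -sqrf_eq0 expr2.
exact: x0 (mem_index_enum _).
Qed.

Lemma measurable_sphere : measurable (@sphere R n).
Proof.
have -> : @sphere R n = [set x | dot x x = 1].
  apply/seteqP; split=> x /=; rewrite /sphere/= /enorm => x1.
    by rewrite -[LHS]sqr_sqrtr ?dot_ge0// x1 expr1n.
  by rewrite x1 sqrtr1.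
rewrite -[X in measurable X]setTI.
have mdot : measurable_fun setT (fun x => dot x x).
  by apply: measurable_sum => i; apply: measurable_funM => //;
    exact: measurable_coord.
exact (mdot measurableT [set 1] (measurable_set1 1)).
Qed.

End sphere_measure_theory.

Section sphere_measure_finite.
Variable R : realType.

Let cube (n : nat) : set 'rV[R]_n :=
  [set x : 'rV[R]_n | forall i, -1 <= x 0 i <= 1].
Arguments cube : clear implicits.

Let measurable_cube (n : nat) : measurable (cube n).
Proof.
have -> : cube n =
    \big[setI/setT]_(i < n) [set x : 'rV[R]_n | x 0 i \in `[-1, 1]].
  rewrite -bigcap_seq; apply/seteqP; split=> x /= xI i.
    by move=> _ /=; rewrite in_itv/=.
  by have := xI i (mem_index_enum _); rewrite /= in_itv.
apply: bigsetI_measurable => i _; rewrite -[X in measurable X]setTI.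
exact (@measurable_coord R n i measurableT `[-1, 1]%classic (measurable_itv _)).
Qed.

Let lebesgue_cube_fin (n : nat) : (lebesgue_rV R n (cube n) < +oo)%E.
Proof.
elim: n => [|n IH]; first by rewrite /= diracE ltry.
rewrite /= /lebesgue_rVS /pushforward.
have -> : consrV (n:=n) @^-1` cube n.+1 = `[-1, 1]%classic `*` cube n.
  apply/seteqP; split=> -[a x] /=.
    move=> ax; split=> [|i].
      by have := ax ord0; rewrite consrV0 in_itv.
    by have := ax (rshift 1 i); rewrite consrVS.
  rewrite in_itv/= => -[a1 x1] i; case: (@split_ordP 1 n i) => j ->.
    by rewrite ord1 (_ : lshift n 0 = ord0) ?consrV0//; exact: val_inj.
  by rewrite consrVS.
rewrite product_measure1E//; last exact: measurable_cube.
have itv_fin : (lebesgue_measure (`[(-1)%R, 1%R]%classic : set R) < +oo)%E.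
  by rewrite lebesgue_measure_itv/=; case: ifP; rewrite ltry.
by rewrite lte_mul_pinfty// ge0_fin_numE.
Qed.

(** The unit ball lies in the cube of side 2. *)
Lemma sphere_measure_fin n : (@sphere_measure R n setT < +oo)%E.
Proof.
rewrite /sphere_measure /pushforward preimage_setT /mscale/= /mrestr.
rewrite lte_mul_pinfty//.
apply: (le_lt_trans _ (lebesgue_cube_fin n)); apply: le_measure; rewrite ?inE.
- by apply: measurableI => //; exact: measurable_punctured_ball.
- exact: measurable_cube.
move=> x [_ /andP[_ x1]] i; rewrite -ler_norml.
rewrite -sqrtr_sqr (le_trans _ x1)// ler_wsqrtr// /dot (bigD1 i)//= -expr2.
by rewrite lerDl sumr_ge0// => j _; rewrite -expr2 sqr_ge0.
Qed.

(** The cone over a great subsphere lies in its hyperplane. *)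
Lemma sphere_measure_hyperplane n (T : 'rV[R]_n) : T != 0 ->
  @sphere_measure R n [set x | dot x T = 0] = 0%E.
Proof.
move=> T0; rewrite /sphere_measure /pushforward /mscale/= /mrestr.
rewrite [X in (_ * X)%E](_ : _ = 0%E) ?mule0//.
apply: (subset_measure0 _ _ _ (lebesgue_hyperplane 0 T0)).
- apply: measurableI; last exact: measurable_punctured_ball.
  rewrite -[X in measurable X]setTI.
  exact (@measurable_unitv R n measurableT _ (measurable_hyperplane T 0)).
- exact: measurable_hyperplane.
move=> x [/= xT /andP[x0 _]]; move: xT; rewrite /unitv dotZl => /eqP.
by rewrite mulf_eq0 invr_eq0 gt_eqF//= => /eqP.
Qed.

End sphere_measure_finite.

(** * The defect of additivity of the positive part *)

Section positive_part_defect.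
Variable R : realType.
Implicit Types a b : R.

Definition pos_part a : R := Num.max a 0.

Definition pos_defect a b : R := pos_part a + pos_part b - pos_part (a + b).

Lemma pos_part_ge0 a : 0 <= pos_part a.
Proof. by rewrite le_max lexx orbT. Qed.

Lemma pos_defect_ge0 a b : 0 <= pos_defect a b.
Proof.
rewrite /pos_defect /pos_part.
case: (lerP a 0); case: (lerP b 0); case: (lerP (a + b) 0); lra.
Qed.

Lemma pos_defect_eq0 a b : pos_defect a b = 0 <-> 0 <= a * b.
Proof.
rewrite /pos_defect /pos_part.
by case: (lerP a 0); case: (lerP b 0); case: (lerP (a + b) 0) => *; split=> *;
  first [nra|lra].
Qed.

Lemma pos_part_norm a : `|pos_part a| <= `|a|.
Proof. by rewrite ger0_norm ?pos_part_ge0// ge_max ler_norm normr_ge0. Qed.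

Lemma pos_partZ c a : 0 <= c -> pos_part (c * a) = c * pos_part a.
Proof. by move=> c0; rewrite /pos_part maxr_pMr// mulr0. Qed.

End positive_part_defect.

(** * The integrand of the vertex contribution *)

Section net_chi.
Variables (R : realType) (n : nat).
Implicit Types (G : graph R n) (q e T : 'rV[R]_n).

Lemma measurable_chi T : measurable_fun setT (chi T).
Proof.
apply: measurable_fun_ifT => //.
by apply: measurable_fun_ler => //; exact: measurable_dotl.
Qed.

Lemma chi_norm T e : `|chi T e| = 1.
Proof. by rewrite /chi; case: ifP; rewrite ?normrN normr1. Qed.

(** The number of edge ends at q along which the height in the direction e
    descends minus the number of those along which it ascends, ends orthogonal
    to e being counted as ascending. *)
Definition net_chi G q e : R :=
  \sum_(h | @end_vertex _ _ G h == q) chi (end_tangent h) e.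

Lemma measurable_net_chi G q : measurable_fun setT (net_chi G q).
Proof.
have -> : net_chi G q = fun e =>
    \sum_h if @end_vertex _ _ G h == q then chi (end_tangent h) e else 0.
  by apply/funext => e; exact: big_mkcond.
apply: measurable_sum => h; case: (_ == q) => //; exact: measurable_chi.
Qed.

Lemma net_chi_norm G q e : `|net_chi G q e| <= #|{: edge G * bool}|%:R.
Proof.
apply: le_trans (ler_norm_sum _ _ _) _.
under eq_bigr do rewrite chi_norm.
rewrite sumr_const ler_nat; exact: max_card.
Qed.

Lemma net_chi_notin G q : q \notin vert G -> net_chi G q = fun=> 0.
Proof.
move=> qG; apply/funext => e; rewrite /net_chi big_pred0// => -[a b].
apply/negbTE; apply: contra qG => /eqP <-.
by have [a0 a1] := curve_ends a; rewrite /end_vertex; case: b.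
Qed.

Lemma ntcE G q :
  ntc G q = pi * sphere_average (fun e => pos_part (net_chi G q e)).
Proof. by []. Qed.

Lemma sphere_fin : (@sphere_measure R n (@sphere R n) < +oo)%E.
Proof.
apply: le_lt_trans (sphere_measure_fin R n).
by apply: le_measure; rewrite ?inE//; exact: measurable_sphere.
Qed.

Lemma bounded_sphere_integrable (f : 'rV[R]_n -> R) M :
  measurable_fun setT f -> (forall e, `|f e| <= M) ->
  (@sphere_measure R n).-integrable (@sphere R n) (EFin \o f).
Proof.
move=> mf fM; apply: measurable_bounded_integrable.
- exact: measurable_sphere.
- exact: sphere_fin.
- exact: measurable_funS mf.
- exists M; split; first exact: num_real.
  by move=> x Mx e _ /=; apply: le_trans (fM e) (ltW Mx).
Qed.

End net_chi.

Section sphere_average_defect.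
Variables (R : realType) (n : nat).
Implicit Types f g : 'rV[R]_n -> R.

Definition avg_defect f g : R :=
  sphere_average (fun e => pos_defect (f e) (g e)).

Lemma sphere_average_pos_partD f g (M : R) :
  measurable_fun setT f -> measurable_fun setT g ->
  (forall e, `|f e| <= M) -> (forall e, `|g e| <= M) ->
  sphere_average (fun e => pos_part (f e + g e)) =
  sphere_average (fun e => pos_part (f e)) +
  sphere_average (fun e => pos_part (g e)) -
  avg_defect f g.
Proof.
move=> mf mg fM gM; rewrite /avg_defect /sphere_average /pos_defect.
have mpos (h : 'rV[R]_n -> R) : measurable_fun setT h ->
    measurable_fun setT (fun e : 'rV[R]_n => pos_part (h e)).
  by move=> mh; exact: measurable_maxr.
have posM (h : 'rV[R]_n -> R) (K : R) : (forall e, `|h e| <= K) ->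
    forall e, `|pos_part (h e)| <= K.
  by move=> hK e; apply: le_trans (hK e); exact: pos_part_norm.
have fgM e : `|f e + g e| <= M + M by rewrite (le_trans (ler_normD _ _)) ?lerD.
have If := bounded_sphere_integrable (mpos _ mf) (posM _ _ fM).
have Ig := bounded_sphere_integrable (mpos _ mg) (posM _ _ gM).
have Ifg := bounded_sphere_integrable
  (mpos _ (measurable_funD mf mg)) (posM _ _ fgM).
have mS := @measurable_sphere R n.
have pM e : `|pos_part (f e) + pos_part (g e)| <= M + M.
  by rewrite (le_trans (ler_normD _ _))// lerD ?posM.
have Isum := bounded_sphere_integrable
  (measurable_funD (mpos _ mf) (mpos _ mg)) pM.
rewrite RintegralB//.
by rewrite RintegralD// mulrBr mulrDr opprB addrC subrK.
Qed.

Lemma avg_defect_ge0 f g : 0 <= avg_defect f g.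
Proof.
apply: mulr_ge0; first by rewrite invr_ge0 fine_ge0.
apply: Rintegral_ge0 => e _.
exact: pos_defect_ge0.
Qed.

Lemma measurable_pos_defect f g :
  measurable_fun setT f -> measurable_fun setT g ->
  measurable_fun setT (fun e => pos_defect (f e) (g e)).
Proof.
move=> mf mg; apply: measurable_funB; last first.
  by apply: measurable_maxr => //; exact: measurable_funD.
by apply: measurable_funD; exact: measurable_maxr.
Qed.

Lemma integrable_pos_defect f g (M : R) :
  measurable_fun setT f -> measurable_fun setT g ->
  (forall e, `|f e| <= M) -> (forall e, `|g e| <= M) ->
  (@sphere_measure R n).-integrable (@sphere R n)
    (EFin \o (fun e => pos_defect (f e) (g e))).
Proof.
move=> mf mg fM gM.
apply: (@bounded_sphere_integrable _ _ _ (M + M)) => [|e].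
  exact: measurable_pos_defect.
rewrite ger0_norm ?pos_defect_ge0//.
have le_pos h K : `|h| <= K -> pos_part h <= K :> R.
  by move=> hK; rewrite (le_trans (ler_norm _))// (le_trans (pos_part_norm _)).
have := pos_part_ge0 (f e + g e); have := le_pos _ _ (fM e).
have := le_pos _ _ (gM e); rewrite /pos_defect; lra.
Qed.

(** The defect is nonnegative, so its average vanishes only if it vanishes
    almost everywhere. *)
Lemma avg_defect_eq0 f g (M : R) :
  measurable_fun setT f -> measurable_fun setT g ->
  (forall e, `|f e| <= M) -> (forall e, `|g e| <= M) ->
  avg_defect f g = 0 <->
  {ae @sphere_measure R n, forall e, sphere e -> 0 <= f e * g e}.
Proof.
move=> mf mg fM gM; have mS := @measurable_sphere R n.
have ID := integrable_pos_defect mf mg fM gM.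
transitivity (\int[@sphere_measure R n]_(e in @sphere R n)
    (pos_defect (f e) (g e))%:E = 0)%E.
  rewrite /avg_defect /sphere_average /sphere_area /Rintegral.
  split; last first.
    by move=> ->; rewrite mulr0.
  (* If the area were 0, the integral would vanish as well. *)
  move=> /eqP; rewrite mulf_eq0 invr_eq0 => /orP[S0|I0].
    have S0' : @sphere_measure R n (@sphere R n) = 0%E.
      by rewrite -[LHS]fineK ?(eqP S0)// ge0_fin_numE// sphere_fin.
    rewrite -(@integral_abs_eq0 _ _ _ (@sphere_measure R n) _ _ mS
      (measurable_int _ ID) S0').
    apply: eq_integral => e _ /=.
    by rewrite ger0_norm// pos_defect_ge0.
  by rewrite -[LHS]fineK ?(eqP I0)//; exact: integrable_fin_num ID.
have -> : (\int[@sphere_measure R n]_(e in @sphere R n)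
      (pos_defect (f e) (g e))%:E =
    \int[@sphere_measure R n]_(e in @sphere R n)
      `|(pos_defect (f e) (g e))%:E|)%E.
  by apply: eq_integral => e _; rewrite abse_EFin ger0_norm// pos_defect_ge0.
rewrite (ae_eq_integral_abs _ mS (measurable_int _ ID)).
split; apply: filterS => e /=.
- by move=> H Se; apply/pos_defect_eq0; case: (H Se).
- by move=> H Se; congr _%:E; apply/pos_defect_eq0; exact: H.
Qed.

Lemma sphere_average0 : sphere_average (fun _ : 'rV[R]_n => 0 : R) = 0.
Proof.
rewrite /sphere_average Rintegral_cst ?mul0r ?mulr0//.
exact: measurable_sphere.
Qed.

Lemma avg_defect0 f g : (forall e, f e * g e = 0) -> avg_defect f g = 0.
Proof.
move=> fg0; rewrite /avg_defect (_ : (fun _ => _) = fun=> 0).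
  exact: sphere_average0.
by apply/funext => e; apply/pos_defect_eq0; rewrite fg0.
Qed.

End sphere_average_defect.

(** * Net total curvature of a union *)

Section union.
Variables (R : realType) (n : nat) (G1 G2 : graph R n).
Hypothesis meet_vert : forall x, carrier G1 x -> carrier G2 x ->
  x \in vert G1 /\ x \in vert G2.
Let G := union_graph meet_vert.

Lemma net_chi_union q e : net_chi G q e = net_chi G1 q e + net_chi G2 q e.
Proof.
have pairE (H : graph R n) : net_chi H q e = \sum_a \sum_b
    if end_vertex (a, b) == q then chi (@end_tangent _ _ H (a, b)) e else 0.
  rewrite pair_bigA /= /net_chi big_mkcond.
  by apply: eq_bigr => -[a b] _.
by rewrite !pairE big_sumType.
Qed.

Definition degree_bound : R :=
  (maxn #|{: edge G1 * bool}| #|{: edge G2 * bool}|)%:R.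

Lemma net_chi_norml q e : `|net_chi G1 q e| <= degree_bound.
Proof. by rewrite (le_trans (net_chi_norm _ _ _))// ler_nat leq_maxl. Qed.

Lemma net_chi_normr q e : `|net_chi G2 q e| <= degree_bound.
Proof. by rewrite (le_trans (net_chi_norm _ _ _))// ler_nat leq_maxr. Qed.

Lemma ntc_union q :
  ntc G q = ntc G1 q + ntc G2 q - pi * avg_defect (net_chi G1 q) (net_chi G2 q).
Proof.
rewrite !ntcE -mulrDr -mulrBr; congr (_ * _).
rewrite -(sphere_average_pos_partD
  (measurable_net_chi _ _) (measurable_net_chi _ _)
  (@net_chi_norml q) (@net_chi_normr q)).
by congr sphere_average; apply/funext => e; rewrite net_chi_union.
Qed.

(** The sums over vertices may all be taken over the vertices of the union,
    since a graph contributes 0 at points that are not its vertices; and the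
    defect vanishes wherever one of the two graphs has no vertex, which leaves
    only the intersection points. *)
Lemma NTC_union N (p : 'I_N -> 'rV[R]_n) : injective p ->
  carrier G1 `&` carrier G2 = range p ->
  NTC G = NTC G1 + NTC G2 -
    pi * \sum_(j < N) avg_defect (net_chi G1 (p j)) (net_chi G2 (p j)).
Proof.
move=> p_inj G12.
have ntc0 (H : graph R n) q : q \notin vert H -> ntc H q = 0.
  move=> qH; rewrite ntcE (_ : (fun _ => _) = fun=> 0).
    by rewrite sphere_average0 mulr0.
  by apply/funext => e; rewrite net_chi_notin// /pos_part maxxx.
rewrite {1}/NTC big_sumType /=.
under eq_bigr do rewrite ntc_union.
rewrite !big_split /= sumrN.
rewrite -(@big_fset_incl _ _ _ _ (vert G1) _ (ntc G1)); last 2 first.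
- exact: fsubsetUl.
- by move=> x _; exact: ntc0.
rewrite -(@big_fset_incl _ _ _ _ (vert G2) _ (ntc G2)); last 2 first.
- exact: fsubsetUr.
- by move=> x _; exact: ntc0.
rewrite -(@big_fset_incl _ _ _ _ [fset p j | j in 'I_N]%fset _
  (fun q => pi * avg_defect (net_chi G1 q) (net_chi G2 q))); last 2 first.
- apply/fsubsetP => _ /imfsetP[j _ ->] /=.
  have [c1 c2] : (carrier G1 `&` carrier G2) (p j) by rewrite G12; exists j.
  have [v1 _] := meet_vert c1 c2.
  exact: (fsubsetP (fsubsetUl (vert G1) (vert G2))).
- move=> x _ xp; rewrite avg_defect0 ?mulr0// => e.
  have [x1|x1] := boolP (x \in vert G1); last by rewrite net_chi_notin ?mul0r.
  rewrite mulrC net_chi_notin ?mul0r//; apply: contra xp => x2.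
  have [j _ <-] : range p x by rewrite -G12; split; left.
  by apply/imfsetP; exists j.
rewrite big_imfset /=; last by move=> i j _ _; exact: p_inj.
have assoc (a b c k l : R) : a + b - c + (k + l) = a + k + (b + l) - c by ring.
by rewrite big_enum /= [in RHS]mulr_sumr assoc.
Qed.

End union.

(** * Points where arcs meet in a 1-manifold *)

Lemma connected_sub_piece (T : topologicalType) (I : Type) (C : set T)
    (A : I -> set T) :
  connected C -> C !=set0 -> (forall i, open (A i)) ->
  (forall i j x, A i x -> A j x -> i = j) -> C `<=` \bigcup_i A i ->
  exists i, C `<=` A i.
Proof.
move=> cC [c Cc] oA dA CA; have [i _ Aic] := CA c Cc; exists i.
suff <- : C `&` A i = C by move=> x [].
apply: cC; first by exists c.
  by exists (A i).
exists (~` \bigcup_(j in [set j | j <> i]) A j).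
  by apply: open_closedC; apply: bigcup_open => j _.
apply/seteqP; split=> x [Cx Ax]; split=> //.
  by move=> [j /= ji Ajx]; apply: ji; exact: dA Ajx Ax.
have [j _ Ajx] := CA x Cx; have [<-//|ji] := pselect (j = i).
by case: Ax; exists j.
Qed.

(** A Hausdorff space M is covered by finitely many arcs, the arms, which may
    meet each other and themselves only in end points. Openness of pieces of M
    is obtained by complementation, finite unions of closed subarcs being
    closed. *)
Section spokes.
Variables (R : realType) (M : topologicalType) (I : finType).
Variables (arm : I -> R -> M) (L : R).
Hypothesis L_gt0 : 0 < L.
Hypothesis hausdorff_M : hausdorff_space M.
Hypothesis arm_continuous : forall i, {within `[0, L], continuous (arm i)}.
Hypothesis arm_cover : forall x, exists i t, 0 <= t <= L /\ arm i t = x.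
Hypothesis arm_once : forall i j s t, 0 < s < L -> 0 <= t <= L ->
  arm i s = arm j t -> i = j /\ s = t.

Lemma closed_arm i a b : 0 <= a -> b <= L -> closed (arm i @` `[a, b]).
Proof.
move=> a0 bL; apply: compact_closed => //; apply: continuous_compact.
  apply: (continuous_subspaceW _ (@arm_continuous i)) => t /=.
  rewrite !in_itv/= => /andP[a_t t_b].
  by rewrite (le_trans a0)//= (le_trans t_b).
exact: segment_compact.
Qed.

Lemma closed_arms (P : pred I) (a b : I -> R) :
  (forall i, 0 <= a i) -> (forall i, b i <= L) ->
  closed [set x | exists i t, [/\ P i, a i <= t <= b i & arm i t = x]].
Proof.
move=> a0 bL.
rewrite (_ : [set x | _] = \bigcup_(i in [set i | P i]) arm i @` `[a i, b i]).
  apply: closed_bigcup; first exact: finite_finset.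
  by move=> i _; exact: closed_arm.
apply/seteqP; split=> [x [i [t [Pi tab <-]]]|x [i Pi [t tab <-]]].
  by exists i => //; exists t => //=; rewrite in_itv.
by exists i, t; split => //; move: tab; rewrite /= in_itv.
Qed.

Lemma open_arm i a : 0 <= a <= L -> open (arm i @` `]a, L[).
Proof.
move=> /andP[a0 aL]; rewrite -[X in open X]setCK; apply: closed_openC.
rewrite (_ : ~` _ =
   [set y | exists j t, [/\ j != i, 0 <= t <= L & arm j t = y]] `|`
   (arm i @` `[0, a] `|` arm i @` `[L, L])).
  apply: closedU.
    exact: (@closed_arms (fun j => j != i) (fun=> 0) (fun=> L)).
  by apply: closedU; apply: closed_arm => //; exact: ltW.
apply/seteqP; split=> y.
  move=> yA; have [j [t [/andP[t0 tL] ty]]] := arm_cover y.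
  have [ji|ji] := eqVneq j i; last by left; exists j, t; rewrite t0 tL.
  right; have [ta|at_] := leP t a.
    by left; exists t; rewrite -?ji //= in_itv/= t0.
  right; exists t; rewrite -?ji//= in_itv/= tL andbT leNgt; apply/negP => tL'.
  by apply: yA; exists t; rewrite -?ji//= in_itv/= at_.
move=> yC [s /=]; rewrite in_itv/= => /andP[as_ sL] sy.
have s0L : 0 < s < L by rewrite (le_lt_trans a0).
have := @arm_once i _ s _ s0L; case: yC => [[j [t [ji t0L ty]]]|[|]].
- move=> /(_ j t t0L); rewrite sy ty => /(_ erefl)[/esym/eqP].
  by rewrite (negbTE ji).
- move=> [t /=]; rewrite in_itv/= => /andP[t0 ta] ty /(_ i t).
  rewrite t0 (le_trans ta aL) sy ty => /(_ isT erefl)[_ st].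
  by move: as_; rewrite st ltNge ta.
- move=> [t /=]; rewrite in_itv/= => /andP[Lt tL] ty /(_ i t).
  rewrite tL (le_trans (ltW L_gt0) Lt) sy ty => /(_ isT erefl)[_ st].
  by move: sL; rewrite st ltNge Lt.
Qed.

Definition hub x := forall i t, 0 < t <= L -> arm i t <> x.

Lemma hub_start x i t : hub x -> 0 <= t <= L -> arm i t = x -> t = 0.
Proof.
move=> xhub /andP[t0 tL] tx; apply/eqP; rewrite eq_le t0 andbT leNgt.
by apply/negP => t_gt0; apply: (xhub i t); rewrite ?t_gt0.
Qed.

Lemma hub_arm x : hub x -> exists i, arm i 0 = x.
Proof.
move=> xhub; have [i [t [t0L tx]]] := arm_cover x.
by exists i; rewrite -[in LHS](hub_start xhub t0L tx).
Qed.

Lemma open_star x (s : I -> R) : hub x -> (forall i, 0 < s i <= L) ->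
  open [set y | exists i t, [/\ arm i 0 = x, 0 <= t < s i & arm i t = y]].
Proof.
move=> xhub s0L; rewrite -[X in open X]setCK; apply: closed_openC.
rewrite (_ : ~` _ =
   [set y | exists i t, [/\ arm i 0 == x, s i <= t <= L & arm i t = y]] `|`
   [set y | exists i t, [/\ arm i 0 != x, 0 <= t <= L & arm i t = y]]).
  apply: closedU.
    apply: (@closed_arms (fun i => arm i 0 == x) s (fun=> L)) => // i.
    by have /andP[/ltW] := s0L i.
  exact: (@closed_arms (fun i => arm i 0 != x) (fun=> 0) (fun=> L)).
apply/seteqP; split=> y.
  move=> yS; have [i [t [/andP[t0 tL] ty]]] := arm_cover y.
  have [ix|ix] := eqVneq (arm i 0) x; last by right; exists i, t; rewrite t0 tL.
  left; exists i, t; rewrite ix eqxx tL andbT; split => //.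
  by rewrite leNgt; apply/negP => ts; apply: yS; exists i, t; rewrite t0 ts.
move=> yC [j [u [jx /andP[u0 us] uy]]].
have /andP[_ sL] := s0L j; have uL := lt_le_trans us sL.
have [u_gt0|u_le0] := ltP 0 u; last first.
  have {u_le0}u0' : u = 0 by apply/eqP; rewrite eq_le u_le0.
  have yx : y = x by rewrite -uy u0'.
  case: yC => -[i [t [ix /andP[t0 tL] ty]]].
    have /andP[s0 _] := s0L i.
    by apply: (xhub i t _); rewrite ?tL ?andbT ?(lt_le_trans s0)// ty.
  have t0' : t = 0 by apply: hub_start xhub _ (etrans ty yx); rewrite t0.
  by move: ix; rewrite -t0' ty yx eqxx.
have u0L : 0 < u < L by rewrite u_gt0.
case: yC => -[i [t [ix t0L ty]]].
  have /andP[t0 tL] := t0L; have /andP[s0 _] := s0L i.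
  have [||ji ut] := @arm_once j i u t u0L; last 2 first.
  - by rewrite uy ty.
  - by move: us; rewrite ut ji ltNge t0.
  - by rewrite tL (le_trans (ltW s0)).
have [|ji ut] := @arm_once j i u t u0L t0L; first by rewrite uy ty.
by move: ix; rewrite -ji jx eqxx.
Qed.

Lemma arm_near j (U : set M) : nbhs (arm j 0) U ->
  exists2 e, 0 < e <= L & forall t, 0 <= t < e -> U (arm j t).
Proof.
move=> xU; have /subspace_continuousP := @arm_continuous j.
have : `[0, L]%classic 0 by rewrite /= in_itv/= lexx ltW.
move=> /[swap] /[apply] /(_ U xU) /nbhs_ballP[e /= e0 eU].
exists (Num.min e L) => [|t /andP[t0]].
  by rewrite lt_min e0 L_gt0 ge_min lexx orbT.
rewrite lt_min => /andP[te tL]; apply: eU; last by rewrite /= in_itv/= t0 ltW.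
by rewrite /ball/= sub0r normrN ger0_norm.
Qed.

Section chart.
Variables (g : R -> M) (r : R).
Hypothesis g_continuous : continuous g.
Hypothesis g_injective : injective g.
Hypothesis g_open : forall A : set R, open A -> open (g @` A).
Let x := g r.
Hypothesis x_hub : hub x.

Lemma chart_radius : exists2 d, 0 < d & forall y, r - d < y < r + d -> y != r ->
  exists i t, [/\ arm i 0 = x, 0 < t < L & arm i t = g y].
Proof.
set S := [set y | exists i t, [/\ arm i 0 = x, 0 <= t < L & arm i t = y]].
have oS : open S.
  by apply: (@open_star x (fun=> L)) => // i; rewrite L_gt0 lexx.
have Sx : S x.
  by have [i ix] := hub_arm x_hub; exists i, 0; rewrite lexx.
have : nbhs r (g @^-1` S) by apply: g_continuous; exact: open_nbhs_nbhs.
move=> /nbhs_ballP[d /= d0 dS]; exists d => // y ryd yr.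
have [|i [t [ix /andP[t0 tL] ty]]] := dS y.
  by rewrite /ball/= ltr_norml; move: ryd; lra.
exists i, t; split => //; rewrite tL andbT lt_neqAle t0 andbT.
apply: contra_neq yr => t0'; apply: g_injective.
by rewrite -ty -t0' ix.
Qed.

(** One side of a chart at a hub is connected, so it runs inside a single one
    of the disjoint open arms. *)
Lemma chart_side d (a b : R) :
  (forall y, r - d < y < r + d -> y != r ->
  exists i t, [/\ arm i 0 = x, 0 < t < L & arm i t = g y]) ->
  r - d <= a -> a < b -> b <= r + d -> r <= a \/ b <= r ->
  exists2 i, arm i 0 = x & g @` `]a, b[ `<=` arm i @` `]0, L[.
Proof.
move=> rd ra ab bd rab.
have inside y : `]a, b[%classic y ->
    exists i t, [/\ arm i 0 = x, 0 < t < L & arm i t = g y].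
  rewrite /= in_itv/= => yab; apply: rd; first by lra.
  by apply/eqP => yr; case: rab; lra.
have mid : `]a, b[%classic ((a + b) / 2) by rewrite /= in_itv/=; lra.
have [|||||i gi] := @connected_sub_piece M I (g @` `]a, b[)
  (fun i => arm i @` `]0, L[).
- apply: connected_continuous_connected.
    by apply/connected_intervalP/interval_is_interval.
  exact: continuous_subspaceT.
- by exists (g ((a + b) / 2)), ((a + b) / 2).
- by move=> i; apply: open_arm; rewrite lexx ltW.
- move=> i j y [s /= + <-] [t /= + ts]; rewrite !in_itv/= => s0L /andP[t0 tL].
  by have [|] := arm_once s0L _ (esym ts); rewrite ?ltW.
- move=> _ [y yab <-]; have [i [t [_ t0L ty]]] := inside y yab.
  by exists i => //; exists t => //=; rewrite in_itv.
exists i => //; have [j [t [jx t0L ty]]] := inside _ mid.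
have [|s /= + sy] := gi (g ((a + b) / 2)); first by exists ((a + b) / 2).
rewrite in_itv/= => /andP[s0 sL].
have [|ji _] := @arm_once j i t s t0L _ (etrans ty (esym sy)).
  by rewrite !ltW.
by rewrite -ji.
Qed.

(** If only one arm starts at the hub, its initial segments are open
    neighbourhoods, and the point at parameter s separates the hub from the
    points with a larger parameter. *)
Lemma chart_no_turn i s t (J : set R) : arm i 0 = x ->
  (forall j, arm j 0 = x -> j = i) -> 0 < s < t -> t < L ->
  connected (g @` J) -> (g @` J) x -> (g @` J) (arm i t) ->
  ~ (g @` J) (arm i s) -> g @` J `<=` arm i @` `[0, L[ -> False.
Proof.
move=> ix onei /andP[s0 st] tL cJ Jx Jt Js JL.
have sL := lt_trans st tL.
pose U := [set y | exists i u, [/\ arm i 0 = x, 0 <= u < s & arm i u = y]].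
have UE y : U y <-> exists2 u, 0 <= u < s & arm i u = y.
  split=> [[j [u [jx us uy]]]|[u us uy]]; last by exists i, u.
  by exists u => //; rewrite -(onei j jx).
have UJ : (g @` J) `&` U = g @` J.
  apply: cJ.
  - by exists x; split=> //; apply/UE; exists 0; rewrite // lexx.
  - by exists U => //; apply: (@open_star x (fun=> s)) => // _; rewrite s0 ltW.
  exists (~` (arm i @` `]s, L[)).
    by apply: open_closedC; apply: open_arm; rewrite !ltW.
  apply/seteqP; split=> y [Jy]; [move=> /UE[u /andP[u0 us] uy]|move=> yN].
    split=> // -[v /=]; rewrite in_itv/= => /andP[sv vL] vy.
    have [||_ vu] := @arm_once i i v u _ _ (etrans vy (esym uy)).
    + by rewrite (lt_trans s0 sv).
    + by rewrite u0 ltW// (lt_trans us).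
    by move: us; rewrite -vu ltNge ltW.
  split=> //; apply/UE; have [u /=] := JL y Jy.
  rewrite in_itv/= => /andP[u0 uL] uy; exists u => //; rewrite u0/=.
  have [us|su|us] := ltrgtP u s => //.
    by case: yN; exists u => //=; rewrite in_itv/= su.
  by case: Js; rewrite -us uy.
have [_ /UE[u /andP[u0 us] ut]] : ((g @` J) `&` U) (arm i t) by rewrite UJ.
have [||_ tu] := @arm_once i i t u _ _ (esym ut).
  by rewrite (lt_trans s0 st).
  by rewrite u0 ltW// (lt_trans us).
by move: st; rewrite tu ltNge ltW.
Qed.

(** The two sides of a chart around the hub lie in one arm each. No third arm
    can start there, as it would meet the open image of the chart; and the two
    sides lie in different arms, since of two points of one arm the one nearer
    to the hub would separate the other one from the hub, while the side
    containing the other one joins it to the hub and misses the nearer one. *)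
Lemma two_arms : exists i k, i != k /\
  forall j, (arm j 0 == x) = (j == i) || (j == k).
Proof.
have [d d0 rd] := chart_radius.
have [||||i ix gi] := chart_side (a := r) (b := r + d) rd;
  [lra|lra|lra|by left|].
have [||||k kx gk] := chart_side (a := r - d) (b := r) rd;
  [lra|lra|lra|by right|].
have ik j : arm j 0 = x -> j = i \/ j = k.
  move=> jx; have [|e /andP[e0 eL] eU] := @arm_near j (g @` `]r - d, r + d[).
    apply: open_nbhs_nbhs; split; first by apply: g_open; exact: interval_open.
    by rewrite jx; exists r => //=; rewrite in_itv/=; lra.
  have e2 : 0 < e / 2 < L by lra.
  have [|y /=] := eU (e / 2); first by lra.
  rewrite in_itv/= => /andP[ry yr] ye.
  have [yr'|ry'|yr'] := ltgtP y r.
  - right; have [|s /= + sy] := gk (g y).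
      by exists y => //=; rewrite in_itv/= ry.
    rewrite in_itv/= => s0L.
    have [|//] := arm_once e2 _ (etrans (esym ye) (esym sy)).
    by move: s0L; lra.
  - left; have [|s /= + sy] := gi (g y).
      by exists y => //=; rewrite in_itv/= ry'.
    rewrite in_itv/= => s0L.
    have [|//] := arm_once e2 _ (etrans (esym ye) (esym sy)).
    by move: s0L; lra.
  - have e2L : 0 <= e / 2 <= L by lra.
    rewrite yr' in ye; have /eqP := hub_start x_hub e2L (esym ye).
    by rewrite gt_eqF//; lra.
exists i, k; split; last first.
  move=> j; apply/eqP/orP => [/ik[] ->|[] /eqP ->//]; by [left|right].
apply/eqP => ki; rewrite -ki in kx gk ik.
have onei j : arm j 0 = x -> j = i by move=> /ik[].
pose yp := r + d / 2; pose ym := r - d / 2.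
have [|s /= s0L sp] := gi (g yp).
  by exists yp => //=; rewrite in_itv/= /yp; lra.
have [|t /= t0L tm] := gk (g ym).
  by exists ym => //=; rewrite in_itv/= /ym; lra.
rewrite !in_itv/= in s0L t0L; case/andP: s0L => s0 sL; case/andP: t0L => t0 tL.
have cJ a b : connected (g @` `[a, b]).
  apply: connected_continuous_connected; first exact: segment_connected.
  exact: continuous_subspaceT.
have hub0 : (arm i @` `[0, L[) x by exists 0 => //=; rewrite in_itv/= lexx.
have [st|ts|st] := ltgtP s t.
- apply: (@chart_no_turn i s t `[ym, r]) => //.
  + by rewrite s0.
  + by exists r => //=; rewrite in_itv/= /ym; lra.
  + by exists ym => //=; rewrite in_itv/= /ym; lra.
  + rewrite sp => -[y /= + /g_injective yE]; rewrite in_itv/= yE /ym /yp; lra.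
  + move=> z [y /= + <-]; rewrite in_itv/= => yr.
    have [->//|yr'] := eqVneq y r.
    have [|u /= + uy] := gk (g y).
      exists y => //=; rewrite in_itv/= [y < r]lt_neqAle yr'.
      by move: yr; rewrite /ym; lra.
    by rewrite in_itv/= => /andP[u0 uL]; exists u => //=; rewrite in_itv/= ltW.
- apply: (@chart_no_turn i t s `[r, yp]) => //.
  + by rewrite t0.
  + by exists r => //=; rewrite in_itv/= /yp; lra.
  + by exists yp => //=; rewrite in_itv/= /yp; lra.
  + rewrite tm => -[y /= + /g_injective yE]; rewrite in_itv/= yE /ym /yp; lra.
  + move=> z [y /= + <-]; rewrite in_itv/= => yr.
    have [->//|yr'] := eqVneq y r.
    have [|u /= + uy] := gi (g y).
      exists y => //=; rewrite in_itv/= [r < y]lt_neqAle eq_sym yr'.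
      by move: yr; rewrite /yp; lra.
    by rewrite in_itv/= => /andP[u0 uL]; exists u => //=; rewrite in_itv/= ltW.
- have /g_injective : g yp = g ym by rewrite -sp -tm st.
  by rewrite /yp /ym; lra.
Qed.

End chart.

End spokes.

(** * Heights along an edge near its ends *)

Section monotone_ends.
Variables (R : realType) (n : nat).
Implicit Types (e T : 'rV[R]_n) (c : R -> 'rV[R]_n).

Lemma dotNl e T : dot (- e) T = - dot e T.
Proof. by rewrite -scaleN1r dotZl mulN1r. Qed.

Lemma dotNr e T : dot e (- T) = - dot e T.
Proof. by rewrite dotC dotNl dotC. Qed.

Lemma continuous_dotr e : continuous (dot e).
Proof.
move=> y; rewrite /dot; apply: cvg_big => [||i _].
- exact: add_continuous.
- exact: nbhs_filter.
have ny : ProperFilter (nbhs y) by exact: nbhs_pfilter.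
by apply: cvgM; [exact: cvg_cst|exact: coord_continuous].
Qed.

Lemma secant_lt0 c t e : derivable c t 1 -> dot e (derive1 c t) < 0 ->
  exists2 d, 0 < d & forall h, h != 0 -> `|h| < d ->
    h^-1 * (dot e (c (t + h)) - dot e (c t)) < 0.
Proof.
move=> ct; rewrite derive1E => lt0.
have : dot e (h^-1 *: (c (h *: 1 + t) - c t)) @[h --> 0^'] --> dot e ('D_1 c t).
  by apply: continuous_cvg; [exact: continuous_dotr|exact: ct].
move=> /cvgr_lt => /(_ _ lt0).
rewrite /dnbhs near_withinE => /nbhs_ballP[d /= d0 dlt]; exists d => // h h0 hd.
have := dlt h; rewrite /ball/= sub0r normrN => /(_ hd h0).
rewrite [h *: 1]mulr1 (addrC h) => lt_h.
by rewrite -dotBr dotC -dotZl dotC.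
Qed.

(** The edge run through from the given end, so that both ends start at 0. *)
Definition end_curve (G : graph R n) (h : edge G * bool) (u : R) : 'rV[R]_n :=
  curve h.1 (if h.2 then 1 - u else u).

Lemma end_descent (G : graph R n) (h : edge G * bool) e :
  dot e (end_tangent h) < 0 ->
  exists2 d, 0 < d & forall u, 0 < u < d ->
    dot e (end_curve h u) < dot e (end_vertex h).
Proof.
case: h => a b; have [ca _ _] := curve_C2 a.
have ca0 t : 0 <= t <= 1 -> 0 < (enorm (derive1 (curve a) t))^-1.
  by move=> t01; rewrite invr_gt0 enorm_gt0 curve_regular.
have unitE y : dot e (unitv y) = (enorm y)^-1 * dot e y.
  by rewrite /unitv dotC dotZl dotC.
rewrite /end_tangent/end_curve/end_vertex/=; case: b => /=.
  (* At the parameter 1 the edge is run through backwards: both the direction e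
     and the increment change sign. *)
  rewrite dotNr -dotNl.
  have -> : dot (- e) (unitv (derive1 (curve a) 1)) =
    (enorm (derive1 (curve a) 1))^-1 * dot (- e) (derive1 (curve a) 1).
    by rewrite !dotNl unitE mulrN.
  rewrite pmulr_rlt0 ?ca0 ?ler01 ?lexx// => /secant_lt0-/(_ (ca 1))[d d0 dlt].
  exists d => // u /andP[u0 ud].
  have := dlt (- u).
  rewrite oppr_eq0 gt_eqF// normrN gtr0_norm// => /(_ isT ud).
  by rewrite invrN mulNr oppr_lt0 pmulr_rgt0 ?invr_gt0// !dotNl; lra.
rewrite unitE pmulr_rlt0 ?ca0 ?ler01 ?lexx//.
move=> /secant_lt0-/(_ (ca 0))[d d0 dlt].
exists d => // u /andP[u0 ud].
have := dlt u; rewrite gt_eqF// gtr0_norm// => /(_ isT ud).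
by rewrite add0r pmulr_rlt0 ?invr_gt0// subr_lt0.
Qed.

End monotone_ends.

(** * Local extrema along a parameterization of the double *)

Section double_param_star.
Variables (R : realType) (n : nat) (G : graph R n) (D : double_param G).
Implicit Types (h : edge G * bool * bool) (e q : 'rV[R]_n) (x : dp_space D).

(** Each arc is cut at its midpoint, so that every half has exactly one end
    over a vertex; the half arcs are arms of length 1/2, and the points over
    vertices are hubs. *)
Definition half_arc h (u : R) : dp_space D :=
  dp_arc D h.1 (if h.2 then 1 - u else u).

(** The end of the original graph where a half arc starts. *)
Definition base_end h : edge G * bool := (h.1.1, h.2).

Let L : R := 2^-1.

Let L_gt0 : 0 < L. Proof. by rewrite /L; lra. Qed.

Let hausdorff_D : hausdorff_space (dp_space D).
Proof. by have [] := dp_manifold D. Qed.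

Lemma half_arc_map h u : 0 <= u <= 1 ->
  dp_map (half_arc h u) = end_curve (base_end h) u.
Proof.
by move=> u01; rewrite /half_arc dp_arcE//; case: h.2 => //; move: u01; lra.
Qed.

Lemma half_arc_map0 h : dp_map (half_arc h 0) = end_vertex (base_end h).
Proof.
rewrite half_arc_map ?lexx ?ler01// /end_curve /end_vertex.
by case: ifP; rewrite ?subr0.
Qed.

Let half_arc_continuous h : {within `[0, L], continuous (half_arc h)}.
Proof.
case: h => a [|]; rewrite /half_arc/=; last first.
  apply: (continuous_subspaceW _ (@dp_arc_continuous _ _ _ D a)) => t /=.
  by rewrite !in_itv/= /L; lra.
apply/subspace_continuousP => t tL.
have /subspace_continuousP/(_ (1 - t)) := @dp_arc_continuous _ _ _ D a.
have t1 : `[0, 1]%classic (1 - t) by move: tL; rewrite /= !in_itv/= /L; lra.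
move=> /(_ t1); apply: cvg_comp => A.
have rev_continuous : (1 - u) @[u --> t] --> 1 - t.
  by apply: cvgB; [exact: cvg_cst|exact: cvg_id].
move=> At; have := rev_continuous _ At.
change (nbhs t (fun u => `[0, 1]%classic (1 - u) -> A (1 - u)) ->
  nbhs t (fun u => `[0, L]%classic u -> A (1 - u))).
apply: filterS => u /= Au uL; apply: Au.
by move: uL; rewrite /= !in_itv/= /L; lra.
Qed.

Let half_arc_cover x : exists h u, 0 <= u <= L /\ half_arc h u = x.
Proof.
have [a [t [t01 <-]]] := dp_cover x; have [tL|Lt] := leP t L.
  by exists (a, false), t; split => //; move: t01; lra.
exists (a, true), (1 - t); split; first by move: t01 Lt; rewrite /L; lra.
by rewrite /half_arc/= subKr.
Qed.

Let half_arc_once h k (s t : R) : 0 < s < L -> 0 <= t <= L ->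
  half_arc h s = half_arc k t -> h = k /\ s = t.
Proof.
case: h => a b; case: k => a' b'; rewrite /half_arc/= /L => sL tL E.
have [||aa st] := dp_once _ _ E.
- by case: b {E}; move: sL; lra.
- by case: b' {E}; move: tL; lra.
rewrite aa; case: b st {E}; case: b' => st;
  by [split; [by []|lra]|exfalso; move: sL tL st; lra].
Qed.

Let vertex_hub x : dp_map x \in vert G -> hub half_arc L x.
Proof.
move=> xG h t /andP[t0 tL] tx; move: xG.
have t1 : 0 < t < 1 by rewrite t0 (le_lt_trans tL)// /L; lra.
rewrite -tx half_arc_map; last by rewrite ltW//; move: t1; lra.
apply/negP; rewrite /end_curve.
case: (base_end h).2; apply: curve_interior => //.
by move: t1; lra.
Qed.

Lemma two_half_arcs x : dp_map x \in vert G -> exists i k, i != k /\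
  forall h, (half_arc h 0 == x) = (h == i) || (h == k).
Proof.
move=> xG; have [_ _ /(_ x)[g [g_cont g_inj g_open [r _ gx]]]] := dp_manifold D.
rewrite -gx; apply: (@two_arms _ _ _ half_arc L) => //.
by rewrite gx; exact: vertex_hub.
Qed.

Definition generic e := forall h : edge G * bool, dot e (end_tangent h) != 0.

(** For generic e the height is strictly monotone along the beginning of each
    half arc, and the half arcs starting at x cover a neighbourhood of x. *)
Lemma local_maxP e x : generic e -> dp_map x \in vert G ->
  local_max e x <->
  forall h, half_arc h 0 = x -> dot e (end_tangent (base_end h)) < 0.
Proof.
move=> e_gen xG.
have vertexE h : half_arc h 0 = x -> end_vertex (base_end h) = dp_map x.
  by move=> <-; rewrite half_arc_map0.
split=> [xmax h hx|hlt].
  rewrite ltNge le_eqVlt eq_sym (negbTE (e_gen _))/=; apply/negP => h_gt0.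
  have : dot (- e) (end_tangent (base_end h)) < 0 by rewrite dotNl oppr_lt0.
  move=> /end_descent[d d0 hd].
  rewrite -hx in xmax.
  have [c /andP[c0 cL] hc] := arm_near L_gt0 half_arc_continuous xmax.
  pose u := Num.min d c / 2.
  have dc0 : 0 < Num.min d c by rewrite lt_min d0.
  have [ud uc] : u < d /\ u < c.
    split; rewrite /u; [have : Num.min d c <= d by rewrite ge_min lexx
      |have : Num.min d c <= c by rewrite ge_min lexx orbT]; lra.
  have u0 : 0 < u by rewrite /u; lra.
  have := hd u; rewrite u0 ud => /(_ isT).
  rewrite (vertexE h hx) !dotNl ltrN2 ltNge => /negP; apply.
  have := hc u; rewrite ltW// uc => /(_ isT) /=; rewrite hx half_arc_map//.
  by rewrite ltW//=; move: cL uc; rewrite /L; lra.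
have /choice[s sP] : forall h, exists s : R, 0 < s <= L /\
    (half_arc h 0 = x -> forall u, 0 < u < s ->
       dot e (end_curve (base_end h) u) < dot e (dp_map x)).
  move=> h; have [hx|hx] := pselect (half_arc h 0 = x); last first.
    by exists L; split; [rewrite L_gt0 lexx|].
  have [d d0 hd] := end_descent (hlt h hx).
  exists (Num.min d L); split=> [|_ u /andP[u0]].
    by rewrite lt_min d0 L_gt0 ge_min lexx orbT.
  by rewrite lt_min -(vertexE h hx) => /andP[ud _]; apply: hd; rewrite u0.
have oS := @open_star _ _ _ half_arc L hausdorff_D half_arc_continuous
  half_arc_cover half_arc_once x s (vertex_hub xG) (fun h => (sP h).1).
apply: filterS (open_nbhs_nbhs (conj oS _)).
  move=> y [h [t [hx /andP[t0 ts] <-]]].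
  have [t_gt0|t_le0] := ltP 0 t; last first.
    by rewrite (_ : t = 0) ?hx//; apply/eqP; rewrite eq_le t_le0.
  have [/andP[_ sL] hs] := sP h.
  rewrite half_arc_map; last by rewrite t0; move: sL ts; rewrite /L; lra.
  by apply: ltW; apply: hs => //; rewrite t_gt0.
have [h hx] := hub_arm half_arc_cover (vertex_hub xG).
by exists h, 0; rewrite lexx hx; have [/andP[->]] := sP h.
Qed.

End double_param_star.

(** * Net numbers of local maxima *)

Section net_local_maxima.
Variables (R : realType) (n : nat) (G : graph R n) (D : double_param G).
Implicit Types (h : edge G * bool * bool) (e q : 'rV[R]_n) (x : dp_space D).

Lemma genericN e : generic G e -> generic G (- e).
Proof. by move=> e_gen h; rewrite dotNl oppr_eq0. Qed.

Lemma local_minN e x : local_min e x <-> local_max (- e) x.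
Proof. by split; apply: filterS => y; rewrite !dotNl lerN2. Qed.

(** At x there is a maximum if both half arcs descend, a minimum if both ascend
    and neither if one of each kind occurs: in every case the difference is half
    the sum of the two signs. *)
Lemma local_extremum_chi e x : generic G e -> dp_map x \in vert G ->
  `[< local_max e x >]%:R - `[< local_min e x >]%:R =
  2^-1 * \sum_(h | half_arc D h 0 == x) chi (end_tangent (base_end h)) e.
Proof.
move=> e_gen xG; have [i [k [ik hE]]] := two_half_arcs xG.
have iP : half_arc D i 0 = x by apply/eqP; rewrite hE eqxx.
have kP : half_arc D k 0 = x by apply/eqP; rewrite hE eqxx orbT.
have -> : \sum_(h | half_arc D h 0 == x) chi (end_tangent (base_end h)) e =
    chi (end_tangent (base_end i)) e + chi (end_tangent (base_end k)) e.
  rewrite (bigD1 i) ?iP//=; congr (_ + _); apply: big_pred1 => h /=.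
  by rewrite hE; have [->|] := eqVneq h i; rewrite ?(negbTE ik) ?andbT.
pose below h := dot e (end_tangent (base_end h)) < 0.
have chiE h : chi (end_tangent (base_end h)) e = if below h then 1 else -1.
  by rewrite /chi /below leNgt; case: ltP.
have -> : `[< local_max e x >] = below i && below k.
  apply/asboolP/andP => [/(local_maxP e_gen xG) xmax|[bi bk]].
    by split; apply: xmax.
  apply/(local_maxP e_gen xG) => h /eqP.
  by rewrite hE => /orP[] /eqP ->.
have -> : `[< local_min e x >] = ~~ below i && ~~ below k.
  have aboveE h : (~~ below h) = (dot (- e) (end_tangent (base_end h)) < 0).
    by rewrite /below dotNl oppr_lt0 -leNgt le_eqVlt eq_sym (negbTE (e_gen _)).
  rewrite !aboveE; apply/asboolP/andP => [/local_minN xmin|[bi bk]].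
    by split; apply: (local_maxP (genericN e_gen) xG).1 xmin _ _.
  apply/local_minN/(local_maxP (genericN e_gen) xG) => h /eqP.
  by rewrite hE => /orP[] /eqP ->.
by rewrite !chiE; case: (below i); case: (below k) => /=; lra.
Qed.

(** Summing over the points above q counts each end of G at q twice, once for
    each copy of its edge. *)
Lemma nlmE e q : generic G e -> q \in vert G -> nlm D e q = net_chi G q e / 2.
Proof.
move=> e_gen qG.
pose X :=
  [fset half_arc D h 0 | h in [pred h | end_vertex (base_end h) == q]]%fset.
have XP x : (x \in X) = (dp_map x == q).
  apply/imfsetP/eqP => [[h /= /eqP hq ->]|xq]; first by rewrite half_arc_map0.
  have xG : dp_map x \in vert G by rewrite xq.
  have [i [k [_ hE]]] := two_half_arcs xG.
  have ix : half_arc D i 0 = x by apply/eqP; rewrite hE eqxx.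
  have iq : end_vertex (base_end i) == q by rewrite -(half_arc_map0 D) ix xq.
  by exists i => //; rewrite ix.
have count (P : dp_space D -> Prop) :
    (#|` fset_set [set x | dp_map x = q /\ P x]|%fset)%:R =
    \sum_(x <- X) `[< P x >]%:R :> R.
  have -> : [set x | dp_map x = q /\ P x] =
      [set` [fset x in X | `[< P x >]]%fset].
    apply/seteqP; split=> x /=; rewrite in_fset/= inE/= XP.
      by move=> [-> /asboolP ->]; rewrite eqxx.
    by move=> /andP[/eqP -> /asboolP].
  rewrite set_fsetK card_fset_sum1 natr_sum -big_fset_condE/= big_mkcond.
  by apply: eq_bigr => x _; case: asboolP.
rewrite /nlm !count -sumrB.
have {count}-> :
    \sum_(x <- X) (`[< local_max e x >]%:R - `[< local_min e x >]%:R) =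
    2^-1 * \sum_h \sum_(x <- X | half_arc D h 0 == x)
      chi (end_tangent (base_end h)) e.
  rewrite (exchange_big_dep xpredT)//= mulr_sumr; apply: eq_big_seq => x.
  by rewrite XP => /eqP xq; apply: local_extremum_chi; rewrite ?xq.
have {XP}X0 h :
    \sum_(x <- X | half_arc D h 0 == x) chi (end_tangent (base_end h)) e =
    if end_vertex (base_end h) == q
    then chi (end_tangent (base_end h)) e else 0.
  rewrite -(half_arc_map0 D) -XP -big_filter; case: ifP => hX.
    rewrite (_ : [seq x <- X | _] = [:: half_arc D h 0]) ?big_seq1//.
    rewrite -(filter_pred1_uniq (fset_uniq X) hX).
    by apply: eq_filter => x /=; rewrite eq_sym.
  rewrite big_filter big_seq_cond big_pred0// => x.
  by apply/negbTE; apply: contraFN hX => /andP[xX /eqP ->].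
under eq_bigr do rewrite X0.
congr (_ / 2); rewrite /net_chi [in RHS]big_mkcond /=.
pose F a b : R :=
  if end_vertex (a, b) == q then chi (@end_tangent _ _ G (a, b)) e else 0.
have -> : \sum_(h : edge G * bool * bool) (if end_vertex (base_end h) == q
    then chi (end_tangent (base_end h)) e else 0) =
    \sum_(a : edge G) \sum_(i : bool) \sum_(b : bool) F a b.
  by rewrite pair_bigA /= pair_bigA /=; apply: eq_bigr => -[[a i] b] _.
have -> : \sum_(h : edge G * bool)
    (if end_vertex h == q then chi (end_tangent h) e else 0) =
    \sum_(a : edge G) \sum_(b : bool) F a b.
  by rewrite pair_bigA /=; apply: eq_bigr => -[a b] _.
rewrite mulr_sumr; apply: eq_bigr => a _.
by rewrite sumr_const card_bool mulr2n; lra.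
Qed.

End net_local_maxima.

(** * Sub-additivity *)

Section generic_directions.
Variables (R : realType) (n : nat).

Lemma end_tangent_neq0 (G : graph R n) (h : edge G * bool) : end_tangent h != 0.
Proof.
have unit_neq0 c : c != 0 -> unitv c != 0 :> 'rV[R]_n.
  by move=> c0; rewrite scaler_eq0 negb_or invr_eq0 gt_eqF ?enorm_gt0.
rewrite /end_tangent; case: h => a [] /=; rewrite ?oppr_eq0 unit_neq0//.
  by rewrite curve_regular ?ler01 ?lexx.
by rewrite curve_regular ?ler01 ?lexx.
Qed.

Lemma ae_generic (G : graph R n) :
  {ae @sphere_measure R n, forall e, generic G e}.
Proof.
apply: filter_forall => h; exists [set e | dot e (end_tangent h) = 0]; split.
- exact: measurable_hyperplane.
- exact/sphere_measure_hyperplane/end_tangent_neq0.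
- by move=> e /= /negP; rewrite negbK => /eqP.
Qed.

End generic_directions.

Theorem proposition5 (R : realType) (n N : nat) (n_gt0 : (0 < n)%N)
    (G1 G2 : graph R n) (p : 'I_N -> 'rV[R]_n) (p_inj : injective p)
    (G12 : carrier G1 `&` carrier G2 = range p)
    (p_vert1 : forall j, p j \in vert G1)
    (p_vert2 : forall j, p j \in vert G2) :
  let G := union_graph (meet_vertices G12 p_vert1 p_vert2) in
  [/\ forall (D : double_param G) (D1 : double_param G1) (D2 : double_param G2),
        NTC G = NTC G1 + NTC G2
          + 2 * pi * \sum_(j < N) (sphere_area R n)^-1 *
              \int[@sphere_measure R n]_(e in @sphere R n)
                (nlm_pos D e (p j) - nlm_pos D1 e (p j) - nlm_pos D2 e (p j)),
      NTC G <= NTC G1 + NTC G2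
    & forall (D1 : double_param G1) (D2 : double_param G2),
        NTC G = NTC G1 + NTC G2 <->
        forall j, {ae @sphere_measure R n, forall e, sphere e ->
          0 <= nlm D1 e (p j) * nlm D2 e (p j)}].
Proof.
move=> G; pose defect j := avg_defect (net_chi G1 (p j)) (net_chi G2 (p j)).
have NTCE : NTC G = NTC G1 + NTC G2 - pi * \sum_(j < N) defect j.
  exact: NTC_union.
have defect_ge0 j : 0 <= defect j by exact: avg_defect_ge0.
have pi0 : 0 < pi :> R by exact: pi_gt0.
have nlm_ae : {ae @sphere_measure R n, forall e,
    [/\ generic G e, generic G1 e & generic G2 e]}.
  apply: filterS3 (ae_generic G) (ae_generic G1) (ae_generic G2).
  by move=> e.
split=> [D D1 D2||D1 D2].
- have integralE j : \int[@sphere_measure R n]_(e in @sphere R n)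
      (nlm_pos D e (p j) - nlm_pos D1 e (p j) - nlm_pos D2 e (p j)) =
    - 2^-1 * \int[@sphere_measure R n]_(e in @sphere R n)
      pos_defect (net_chi G1 (p j) e) (net_chi G2 (p j) e).
    have pG : p j \in vert G by rewrite in_fsetU p_vert1.
    rewrite -RintegralZl; last 2 first.
    + exact: measurable_sphere.
    + exact: integrable_pos_defect (measurable_net_chi _ _)
        (measurable_net_chi _ _)
        (@net_chi_norml _ _ _ _ _) (@net_chi_normr _ _ _ _ _).
    apply: eq_Rintegral_ae; apply: filterS nlm_ae => e [eG e1 e2] _.
    rewrite /nlm_pos !nlmE// net_chi_union -!/(pos_part _) ![_ / 2]mulrC.
    by rewrite !pos_partZ ?invr_ge0// /pos_defect; ring.
  rewrite NTCE; congr (_ + _); rewrite -mulNr !mulr_sumr.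
  apply: eq_bigr => j _; rewrite integralE /defect /avg_defect /sphere_average.
  by set area_inv := (sphere_area R n)^-1; field.
- by rewrite NTCE gerBl; apply: mulr_ge0; [exact: ltW|apply: sumr_ge0 => j _].
- transitivity (forall j, defect j = 0).
    rewrite NTCE; split=> [/eqP|d0]; last by rewrite big1 ?mulr0 ?subr0.
    rewrite -subr_eq0 addrAC subrr add0r oppr_eq0 mulf_eq0 gt_eqF//=.
    by rewrite psumr_eq0// => /allP d0 j; exact/eqP/(d0 j)/mem_index_enum.
  have defectP j := avg_defect_eq0 (measurable_net_chi G1 (p j))
    (measurable_net_chi G2 (p j))
    (@net_chi_norml _ _ G1 G2 _) (@net_chi_normr _ _ G1 G2 _).
  split=> H j.
    have := (defectP j).1 (H j).
    apply: filterS2 nlm_ae => e [_ e1 e2] He Se.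
    by rewrite !nlmE// mulrACA mulr_ge0 ?He// mulr_ge0 ?invr_ge0.
  apply: (defectP j).2; move: (H j).
  apply: filterS2 nlm_ae => e [_ e1 e2] He Se.
  by have := He Se; rewrite !nlmE// mulrACA pmulr_lge0// mulr_gt0 ?invr_gt0.
Qed.
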